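(* Let $\psi:\mathbb{R}^{n+1}\to\mathbb{R}$ be $C^3$ and let $B\in\mathbb{R}^{(n+1)\times(n+1)}$ be invertible with $\det B=1$. Define $g(x):=\psi(Bx)$. Assume the affine normal direction is well defined at $x$ for $g$ and at $y:=Bx$ for $\psi$ (e.g. the corresponding level-set hypersurfaces are elliptic at these points). Then $$d^g_{\mathrm{AN}}(x)\ \parallel\ B^{-1}d^\psi_{\mathrm{AN}}(Bx),$$ where $\parallel$ denotes equality up to a positive scalar multiple (with the inward/elliptic orientation fixed).
   Context: Affine normal direction. For a $C^3$ function $h:\mathbb{R}^{n+1}\to\mathbb{R}$ and a point $x$ with $\nabla h(x)\ne0$, put $e_{n+1}=\nabla h(x)/\|\nabla h(x)\|$ and let $e_1,\dots,e_n$ be an orthonormal basis of $\nabla h(x)^\perp$. For $i,j,p,q\le n$ write $h_{ij}=D^2h(x)[e_i,e_j]$, $h_{n+1,i}=D^2h(x)[e_{n+1},e_i]$, $h_{pqi}=D^3h(x)[e_p,e_q,e_i]$. The affine normal direction is well defined at $x$ when the tangent-tangent block $(h_{ij})_{i,j\le n}$ is invertible, with inverse $(h^{ij})$ ($x$ is elliptic if this block is positive definite); it is then, with the inward orientation and up to a positive scalar, $$d^h_{\mathrm{AN}}(x)\propto\sum_{i}\Big(\sum_{j}h^{ij}\Big(-\tfrac1{n+2}\|\nabla h(x)\|\sum_{p,q}h^{pq}h_{pqj}+h_{n+1,j}\Big)\Big)e_i-e_{n+1}.$$ *)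

(* Defs.v *)
From HB Require Import structures.
From mathcomp Require Import all_boot all_order all_algebra.
From mathcomp Require Import all_classical all_reals all_analysis.

Set Implicit Arguments.
Unset Strict Implicit.
Unset Printing Implicit Defensive.

Import Order.TTheory GRing.Theory Num.Theory.
Import numFieldNormedType.Exports.

Local Open Scope ring_scope.

Section AffineNormalDirection.
Variables (R : realType) (n : nat).

Notation V := 'cV[R]_n.+1.

Implicit Types (h : V -> R) (x u v w d : V) (e : 'I_n -> V) (k : nat).

(* [h] is of class C^(k+1) iff it is Fréchet differentiable and [Dh] is of
   class C^k; as [V] has finite dimension, the latter means that the maps
   [y |-> Dh(y)[v]] are of class C^k for all fixed [v]. *)
Fixpoint class_C k h : Prop :=
  if k is k'.+1 then
    (forall x, differentiable h x) /\ (forall v, class_C k' ('D_v h))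
  else continuous h.

(* The library norm on matrices is the sup norm, hence the explicit Euclidean
   structure. *)
Definition dot u v : R := \sum_k u k 0 * v k 0.

Definition enorm u : R := Num.sqrt (dot u u).

Definition grad h x : V := \col_i 'D_(delta_mx i 0) h x.

(* D^2 h(x)[u, v] and D^3 h(x)[u, v, w], as iterated derivatives along fixed
   vectors. *)
Definition D2 h x u v : R := 'D_u ('D_v h) x.

Definition D3 h x u v w : R := 'D_u ('D_v ('D_w h)) x.

Definition unit_normal h x : V := (enorm (grad h x))^-1 *: grad h x.

(* When [grad h x != 0], its orthogonal complement has dimension [n], so that
   [n] orthonormal vectors in it form a basis of it. *)
Definition tangent_frame h x e : Prop :=
  (forall i j, dot (e i) (e j) = (i == j)%:R) /\
  (forall i, dot (e i) (grad h x) = 0).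

Definition tangent_block h x e : 'M[R]_n := \matrix_(i, j) D2 h x (e i) (e j).

(* The invertibility of the block does not depend on the frame. *)
Definition AN_well_defined h x : Prop :=
  grad h x != 0 /\
  exists2 e, tangent_frame h x e & tangent_block h x e \in unitmx.

Definition AN_vector h x e : V :=
  let Hinv := invmx (tangent_block h x e) in
  \sum_i (\sum_j Hinv i j *
            (- (n + 2)%:R^-1 * enorm (grad h x) *
               (\sum_p \sum_q Hinv p q * D3 h x (e p) (e q) (e j))
             + D2 h x (unit_normal h x) (e j))) *: e i
  - unit_normal h x.

Definition pos_parallel u v : Prop := exists2 c : R, 0 < c & u = c *: v.

(* The affine normal direction is only determined up to a positive scalar:
   [d] is one of its representatives. *)
Definition is_AN_direction h x d : Prop :=
  exists2 e, tangent_frame h x e & pos_parallel d (AN_vector h x e).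

End AffineNormalDirection.

(* Main.v *)
(* With y = B x and a = grad psi y, the derivatives of g at x are those of psi
   at y evaluated at images under B, and grad g x = B^T a; hence B maps a tangent
   frame e of g to a basis of the tangent space of psi.  Contracting the inverse
   tangent block with a bilinear map does not depend on the basis, so
   B (AN_vector g x e) is the formula for psi in a frame f, except that the normal
   a / |a| is replaced by the image of the unit normal of g, whose normal
   component is kappa = |grad g x| / |a|, and the factor |a| by kappa |a|.  The
   tangential part of that image cancels, so that
   B (AN_vector g x e) = kappa (AN_vector psi y f). *)

Require Import Defs.
From HB Require Import structures.
From mathcomp Require Import all_boot all_order all_algebra.
From mathcomp Require Import all_classical all_reals all_analysis.
From mathcomp Require Import ring.

Set Implicit Arguments.
Unset Strict Implicit.
Unset Printing Implicit Defensive.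

Import Order.TTheory GRing.Theory Num.Theory.
Import numFieldNormedType.Exports.

Local Open Scope ring_scope.

(** * Mean value arguments and symmetry of second directional derivatives *)

Section SecondDerivatives.
Variables (R : realType) (V : normedModType R).
Implicit Types (f : V -> R) (p u v w x y : V).

Lemma is_derive_line f p v (t : R) : derivable f (p + t *: v) v ->
  is_derive t 1 (fun s : R => f (p + s *: v)) ('D_v f (p + t *: v)).
Proof.
have quotE : (fun h : R => h^-1 *: (((fun s => f (p + s *: v)) \o shift t)
      (h *: (1 : R)) - f (p + t *: v))) =
    (fun h => h^-1 *: ((f \o shift (p + t *: v)) (h *: v) - f (p + t *: v))).
  apply/funext => h /=; congr (_ *: (f _ - _)).
  have -> : h *: (1 : R) = h by exact: mulr1.
  by rewrite scalerDl addrCA.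
move=> df; apply: DeriveDef; first by rewrite /derivable quotE.
by rewrite /derive quotE.
Qed.

Lemma mvt_line f p v (t : R) : (forall y, derivable f y v) -> 0 < t ->
  exists2 c, 0 <= c <= t & f (p + t *: v) - f p = 'D_v f (p + c *: v) * t.
Proof.
move=> df t0.
have dF (s : R) :
    is_derive s (1 : R) (fun s : R => f (p + s *: v)) ('D_v f (p + s *: v)).
  exact: is_derive_line.
have [|c] := MVT t0 (fun s _ => dF s).
  by apply: derivable_within_continuous => s _; case: (dF s).
rewrite in_itv/= => /andP[c0 ct]; rewrite scale0r addr0 subr0 => ->.
by exists c => //; rewrite !ltW.
Qed.

Lemma is_derive_translate f w y v : derivable f (y + w) v ->
  is_derive y v (fun z => f (z + w)) ('D_v f (y + w)).
Proof.
have quotE : (fun h : R => h^-1 *: (((fun z => f (z + w)) \o shift y)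
      (h *: v) - f (y + w))) =
    (fun h => h^-1 *: ((f \o shift (y + w)) (h *: v) - f (y + w))).
  by apply/funext => h /=; rewrite addrA.
move=> df; apply: DeriveDef; first by rewrite /derivable quotE.
by rewrite /derive quotE.
Qed.

(** Two applications of the mean value theorem: along [u] to the increment of [f] in direction [v],
    then along [v] to ['D_u f]. *)
Lemma second_difference f x u v (t : R) :
    (forall y w, derivable f y w) -> (forall y, derivable ('D_u f) y v) ->
    0 < t ->
  exists a b, [/\ 0 <= a <= t, 0 <= b <= t &
    f (x + t *: u + t *: v) - f (x + t *: u) - (f (x + t *: v) - f x) =
      'D_v ('D_u f) (x + a *: u + b *: v) * t * t].
Proof.
move=> df ddf t0.
pose phi y := f (y + t *: v) - f y.
have dphi y : is_derive y u phi ('D_u f (y + t *: v) - 'D_u f y).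
  apply: is_deriveB; first exact: is_derive_translate.
  by apply: DeriveDef.
have [|a a0t phiE] := @mvt_line phi x u t _ t0; first by move=> y; case: (dphi y).
have [b b0t DE] := mvt_line (x + a *: u) ddf t0.
exists a, b; split => //.
rewrite -DE; rewrite -/(phi (x + t *: u)) -/(phi x) phiE.
by case: (dphi (x + a *: u)) => _ ->.
Qed.

(* Both sides are limits of values of the corresponding iterated derivatives at
   points where they equal the same second difference quotient. *)
Lemma derive_comm f x u v :
    (forall y w, derivable f y w) -> (forall y w w', derivable ('D_w f) y w') ->
    {for x, continuous ('D_u ('D_v f))} -> {for x, continuous ('D_v ('D_u f))} ->
  'D_u ('D_v f) x = 'D_v ('D_u f) x.
Proof.
move=> df ddf cuv cvu; apply/eqP; rewrite -subr_eq0 -normr_eq0.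
apply/eqP/le_anti; rewrite normr_ge0 andbT; apply/ler_addgt0Pl => e e0.
rewrite addr0.
have e20 : 0 < e / 2 by rewrite divr_gt0.
have near_eq (p q r : R) : `|q - r| < e / 2 -> `|p - r| < e / 2 -> `|p - q| <= e.
  move=> qr pr; rewrite (le_trans (ler_distD r p q))// [leRHS]splitr.
  by rewrite (distrC r) lerD// ltW.
have : \forall y \near x, `|'D_u ('D_v f) x - 'D_u ('D_v f) y| < e / 2 /\
                        `|'D_v ('D_u f) x - 'D_v ('D_u f) y| < e / 2.
  by apply: filterI; [move/cvgrPdist_lt: cuv; apply|move/cvgrPdist_lt: cvu; apply].
move=> /nbhs_normP[d /= d0 ball_d].
(* With this step every point [x + a *: u + b *: v] with [a] and [b] in [[0, t]] is within [d] of
   [x]; the summand 1 keeps the denominator positive when [u = v = 0]. *)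
pose t := d / (`|u| + `|v| + 1).
have N0 : 0 < `|u| + `|v| + 1 by rewrite ltr_wpDl ?addr_ge0.
have t0 : 0 < t by rewrite divr_gt0.
have close a b : 0 <= a <= t -> 0 <= b <= t -> `|x - (x + a *: u + b *: v)| < d.
  move=> /andP[a0 at_] /andP[b0 bt].
  rewrite -addrA opprD addNKr normrN.
  rewrite (le_lt_trans (ler_normD _ _))// !normrZ !ger0_norm//.
  rewrite (@le_lt_trans _ _ (t * (`|u| + `|v|)))//.
    by rewrite mulrDr lerD// ler_wpM2r.
  by rewrite /t -mulrA gtr_pMr// mulrC ltr_pdivrMr// mul1r ltrDl.
have [a [b [a0t b0t Dab]]] := second_difference x df (fun y => ddf y u v) t0.
have [b' [a' [b'0t a'0t Dab']]] := second_difference x df (fun y => ddf y v u) t0.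
(* The two second differences differ only in the order of the increments, so cancelling [t] twice
   equates the mixed derivatives at the two intermediate points. *)
have Deq : 'D_v ('D_u f) (x + a *: u + b *: v) =
           'D_u ('D_v f) (x + b' *: v + a' *: u).
  move: Dab Dab'; move: (derive _ _ _) (derive _ _ _) => A A' Dab.
  have -> : x + t *: v + t *: u = x + t *: u + t *: v by rewrite addrAC.
  move=> Dab'; apply: (mulIf (lt0r_neq0 t0)); apply: (mulIf (lt0r_neq0 t0)).
  by rewrite -Dab -Dab' !opprB addrACA [RHS]addrACA [in RHS](addrC (- f _)).
have [_] := ball_d _ (close _ _ a0t b0t).
have [] := ball_d _ (close _ _ a'0t b'0t).
have -> : x + a' *: u + b' *: v = x + b' *: v + a' *: u by rewrite addrAC.
rewrite Deq => uv _ vu; exact: near_eq vu uv.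
Qed.

End SecondDerivatives.

(** * Multilinearity and symmetry of the derivatives of a C^3 function *)

Section CalculusC3.
Variables (R : realType) (n : nat).
Local Notation V := 'cV[R]_n.+1.
Implicit Types (h : V -> R) (x u v w : V).

Lemma derive_linear h x : differentiable h x -> linear (fun v => 'D_v h x : R^o).
Proof. by move=> dh a u v; rewrite !deriveE// linearP. Qed.

(** Linearity in the inner direction holds at every base point, hence as an identity of functions,
    which can be differentiated along [u]. *)
Lemma derive2_linear h u x : (forall y, differentiable h y) ->
    (forall w y, differentiable ('D_w h) y) ->
  linear (fun v => 'D_u ('D_v h) x : R^o).
Proof.
move=> dh ddh a v w.
have -> : 'D_(a *: v + w) h = a \*: 'D_v h + 'D_w h.
  by apply/funext => y; apply: derive_linear.
have dd z : derivable ('D_z h) x u by exact/diff_derivable/ddh.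
by rewrite (deriveD (@derivableZ _ _ _ _ a _ _ (dd v)) (dd w)) (deriveZ a (dd v)).
Qed.

Variables (h : V -> R) (h_C3 : class_C 3 h).

Lemma C3_diff x : differentiable h x. Proof. exact: h_C3.1. Qed.

Lemma C3_diff1 v x : differentiable ('D_v h) x.
Proof. exact: (h_C3.2 v).1. Qed.

Lemma C3_diff2 v w x : differentiable ('D_v ('D_w h)) x.
Proof. exact: ((h_C3.2 w).2 v).1. Qed.

Lemma D2_linearl x v : linear (fun u => D2 h x u v : R^o).
Proof. exact/derive_linear/C3_diff1. Qed.

Lemma D2_linearr x u : linear (fun v => D2 h x u v : R^o).
Proof. exact: derive2_linear C3_diff C3_diff1. Qed.

Lemma D2_sym x u v : D2 h x u v = D2 h x v u.
Proof.
apply: derive_comm => *; try exact/diff_derivable/C3_diff.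
- exact/diff_derivable/C3_diff1.
- exact/differentiable_continuous/C3_diff2.
- exact/differentiable_continuous/C3_diff2.
Qed.

Lemma D3_linear1 x v w : linear (fun u => D3 h x u v w : R^o).
Proof. exact/derive_linear/C3_diff2. Qed.

Lemma D3_linear2 x u w : linear (fun v => D3 h x u v w : R^o).
Proof. by apply: (derive2_linear _ _ (C3_diff1 w)) => *; apply: C3_diff2. Qed.

Lemma D3_linear3 x u v : linear (fun w => D3 h x u v w : R^o).
Proof.
move=> a w w'.
have D2E : 'D_v ('D_(a *: w + w') h) = a \*: 'D_v ('D_w h) + 'D_v ('D_w' h).
  by apply/funext => y; exact: (D2_linearr y v a w w').
have dd z : derivable ('D_v ('D_z h)) x u by exact/diff_derivable/C3_diff2.
rewrite /D3 [LHS](congr1 (fun f => 'D_u f x) D2E).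
by rewrite (deriveD (@derivableZ _ _ _ _ a _ _ (dd w)) (dd w')) (deriveZ a (dd w)).
Qed.

End CalculusC3.

(** * Linear algebra of a change of basis *)

Lemma linear_sumZ (R : pzRingType) (U V : lmodType R) (f : U -> V) (n : nat)
    (c : 'I_n -> R) (u : 'I_n -> U) :
  linear f -> f (\sum_i c i *: u i) = \sum_i c i *: f (u i).
Proof.
move=> lf; pose F : {linear U -> V} := HB.pack f (GRing.isLinear.Build R U V _ f lf).
rewrite -[f]/(F : U -> V) linear_sum; apply: eq_bigr => i _.
exact: linearZ.
Qed.

(** Multiplying on the left by [F] and then by [P] makes the congruent matrix meet its own
    inverse. *)
Lemma invmx_congr (R : comUnitRingType) (n : nat) (P F : 'M[R]_n) :
    P \in unitmx -> F \in unitmx ->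
  P^T *m invmx (P *m F *m P^T) *m P = invmx F.
Proof.
move=> uP uF; have uPT : P^T \in unitmx by rewrite unitmx_tr.
set G := _ *m P^T.
have uG : G \in unitmx by rewrite !unitmx_mul uP uF.
apply: (can_inj (mulKmx uF)); rewrite mulmxV//.
apply: (can_inj (mulKmx uP)).
by rewrite !mulmxA mulmxV ?mulmx1 ?mul1mx.
Qed.

(* The inverse of a Gram matrix is contravariant in the family of vectors, so
   that contracting it with a bilinear map does not depend on the family. *)
Lemma contraction_change_basis (R : comUnitRingType) (U W : lmodType R) (n : nat)
    (e f : 'I_n -> U) (P F : 'M[R]_n) (Phi : U -> U -> W) :
    (forall v, linear (Phi ^~ v)) -> (forall u, linear (Phi u)) ->
    (forall i, e i = \sum_j P i j *: f j) -> P \in unitmx -> F \in unitmx ->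
  \sum_i \sum_j invmx (P *m F *m P^T) i j *: Phi (e i) (e j) =
  \sum_k \sum_l invmx F k l *: Phi (f k) (f l).
Proof.
move=> Phil Phir eE uP uF; rewrite -(invmx_congr uP uF).
set G := invmx (_ *m _).
(* Both arguments of [Phi] are expanded in [f]; once the sums over [k] and [l] are moved outside,
   the coefficient is an entry of [P^T *m G *m P]. *)
transitivity (\sum_i \sum_j \sum_k \sum_l
    (P i k * G i j * P j l) *: Phi (f k) (f l)).
  apply: eq_bigr => i _; apply: eq_bigr => j _.
  rewrite eE (linear_sumZ _ _ (Phil (e j))) scaler_sumr; apply: eq_bigr => k _.
  rewrite eE (linear_sumZ _ _ (Phir (f k))) !scaler_sumr; apply: eq_bigr => l _.
  by rewrite !scalerA mulrA [G i j * _]mulrC.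
under eq_bigr do rewrite exchange_big.
rewrite exchange_big; apply: eq_bigr => k _.
under eq_bigr do rewrite exchange_big.
rewrite exchange_big; apply: eq_bigr => l _.
rewrite mxE scaler_suml exchange_big; apply: eq_bigr => j _.
rewrite mxE mulr_suml scaler_suml; apply: eq_bigr => i _.
by rewrite mxE.
Qed.

(** * Euclidean structure and orthonormal frames of a hyperplane *)

Section Frames.
Variables (R : realType) (n : nat).
Local Notation V := 'cV[R]_n.+1.
Implicit Types (a u v w : V) (e f : 'I_n -> V).

Lemma dotE u v : dot u v = (u^T *m v) 0 0.
Proof. by rewrite mxE; apply: eq_bigr => k _; rewrite mxE. Qed.

Lemma dotC u v : dot u v = dot v u.
Proof. by apply: eq_bigr => k _; rewrite mulrC. Qed.

Lemma dot_linear u : linear (fun v => dot u v : R^o).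
Proof. by move=> c v w; rewrite !dotE linearP/= !mxE. Qed.

Lemma dotZl c u v : dot (c *: u) v = c * dot u v.
Proof. by rewrite mulr_sumr; apply: eq_bigr => k _; rewrite mxE mulrA. Qed.

Lemma dotZr c u v : dot u (c *: v) = c * dot u v.
Proof. by rewrite dotC dotZl dotC. Qed.

Lemma dot_trmx (B : 'M[R]_n.+1) u v : dot (B^T *m u) v = dot u (B *m v).
Proof. by rewrite !dotE trmx_mul trmxK mulmxA. Qed.

Lemma enorm_gt0 a : a != 0 -> 0 < enorm a.
Proof.
move=> a0; rewrite sqrtr_gt0 lt0r sumr_ge0 ?andbT; last first.
  by move=> k _; rewrite -expr2 sqr_ge0.
apply: contra_neq a0 => /psumr_eq0P sq0; apply/colP => k; rewrite mxE.
apply/eqP; rewrite -sqrf_eq0 expr2 sq0// => j _.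
by rewrite -expr2 sqr_ge0.
Qed.

Lemma dotvv a : dot a a = enorm a ^+ 2.
Proof. by rewrite sqr_sqrtr// sumr_ge0// => k _; rewrite -expr2 sqr_ge0. Qed.

(** This is [tangent_frame] for an arbitrary normal vector, so that it also applies to
    [B^T *m a]. *)
Definition orthonormal_perp a e : Prop :=
  (forall i j, dot (e i) (e j) = (i == j)%:R) /\ (forall i, dot (e i) a = 0).

(** The normalized [a] and the [e j] are the columns of a square matrix [M] with [M^T *m M = 1];
    then also [M *m M^T = 1], and the expansion is [w = M *m (M^T *m w)]. *)
Lemma perp_expand a e w : a != 0 -> orthonormal_perp a e ->
  w = (dot a w / enorm a) *: ((enorm a)^-1 *: a) + \sum_j dot (e j) w *: e j.
Proof.
move=> a0 [ee ea]; have na := lt0r_neq0 (enorm_gt0 a0).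
(* Index [ord0] carries the unit normal, and [lift ord0 j] carries [e j]. *)
pose b (k : 'I_n.+1) := oapp e ((enorm a)^-1 *: a) (unlift ord0 k).
pose M : 'M[R]_n.+1 := \matrix_(k, l) b l k 0.
have MTM : M^T *m M = 1%:M.
  apply/matrixP => k l; rewrite !mxE.
  transitivity (dot (b k) (b l)); first by apply: eq_bigr => i _; rewrite !mxE.
  rewrite /b; case: unliftP => [i|] ->; case: unliftP => [j|] -> /=.
  - by rewrite ee (inj_eq lift_inj).
  - by rewrite dotZr ea mulr0.
  - by rewrite dotZl dotC ea mulr0.
  - by rewrite dotZl dotZr dotvv mulrA -invfM -expr2 mulVf// expf_neq0.
have : M *m (M^T *m w) = w by rewrite mulmxA (mulmx1C MTM) mul1mx.
move=> {1}<-; apply/colP => i; rewrite !mxE summxE big_ord_recl; congr (_ + _).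
  rewrite !mxE /b unlift_none /= !mxE.
  under eq_bigr do rewrite !mxE /b unlift_none /= mxE -mulrA.
  by rewrite -mulr_sumr mulrC [(dot a w) / _]mulrC.
apply: eq_bigr => j _; rewrite !mxE /b liftK/= mulrC; congr (_ * _).
by apply: eq_bigr => k _; rewrite !mxE /b liftK.
Qed.

(** By adjointness [B] sends the complement of [B^T *m a] into that of [a], and [invmx B] sends it
    back; the matrices of these two maps are mutually inverse. *)
Lemma change_of_frame (B : 'M[R]_n.+1) a e f : B \in unitmx -> a != 0 ->
    orthonormal_perp (B^T *m a) e -> orthonormal_perp a f ->
  exists2 P : 'M[R]_n, P \in unitmx & forall i, B *m e i = \sum_j P i j *: f j.
Proof.
move=> uB a0 eP fP.
have b0 : B^T *m a != 0.
  by rewrite -(mulmx0 _ B^T) (can_eq (mulKmx _))// unitmx_tr.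
pose P : 'M[R]_n := \matrix_(i, j) dot (f j) (B *m e i).
pose Q : 'M[R]_n := \matrix_(i, j) dot (e j) (invmx B *m f i).
have PE i : B *m e i = \sum_j P i j *: f j.
  rewrite {1}(perp_expand (B *m e i) a0 fP) -dot_trmx dotC eP.2 mul0r scale0r add0r.
  by apply: eq_bigr => j _; rewrite mxE.
have QE i : invmx B *m f i = \sum_j Q i j *: e j.
  rewrite {1}(perp_expand (invmx B *m f i) b0 eP) dot_trmx mulKVmx// dotC fP.2.
  by rewrite mul0r scale0r add0r; apply: eq_bigr => j _; rewrite mxE.
exists P => //; suff QP : Q *m P = 1%:M by case: (mulmx1_unit QP).
(* The identity entry is read as [dot (f i) (f j)], and [f i] is expanded by going through [invmx B]
   and back. *)
apply/matrixP => i j; rewrite !mxE -fP.1 dotC -[f i](mulKVmx uB) QE.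
rewrite mulmx_sumr.
under [in RHS]eq_bigr do rewrite -scalemxAr.
rewrite (linear_sumZ _ _ (dot_linear (f j))).
by apply: eq_bigr => k _; congr (_ * _); rewrite mxE.
Qed.

End Frames.

(** * The affine normal formula for abstract forms and its pullback *)

Section MultilinearForms.
Variables (R : realType) (n : nat).
Local Notation V := 'cV[R]_n.+1.
Implicit Types (u v w : V) (e f : 'I_n -> V).

Definition form_block (H : V -> V -> R) e : 'M[R]_n :=
  \matrix_(i, j) H (e i) (e j).

(* [AN_vector] with the gradient and the second and third derivatives replaced
   by an arbitrary vector and arbitrary forms. *)
Definition form_AN_vector (a : V) (H : V -> V -> R) (T : V -> V -> V -> R) e : V :=
  let Hinv := invmx (form_block H e) in
  let nu := (enorm a)^-1 *: a in
  \sum_i (\sum_j Hinv i j *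
            (- (n + 2)%:R^-1 * enorm a *
               (\sum_p \sum_q Hinv p q * T (e p) (e q) (e j))
             + H nu (e j))) *: e i
  - nu.

Variables (a : V) (H : V -> V -> R) (T : V -> V -> V -> R).
Hypothesis H_linearl : forall v, linear (fun u => H u v : R^o).
Hypothesis H_linearr : forall u, linear (fun v => H u v : R^o).
Hypothesis H_sym : forall u v, H u v = H v u.
Hypothesis T_linear1 : forall v w, linear (fun u => T u v w : R^o).
Hypothesis T_linear2 : forall u w, linear (fun v => T u v w : R^o).
Hypothesis T_linear3 : forall u v, linear (fun w => T u v w : R^o).

Lemma form_block_change_basis (P : 'M[R]_n) e f :
    (forall i, e i = \sum_j P i j *: f j) ->
  form_block H e = P *m form_block H f *m P^T.
Proof.
move=> eE; apply/matrixP => i j; rewrite [LHS]mxE !eE.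
rewrite (linear_sumZ _ _ (H_linearr _)) mxE; apply: eq_bigr => k _.
rewrite (linear_sumZ _ _ (H_linearl _)) [(P^T) _ _]mxE mulrC.
by rewrite mxE; congr (_ * _); apply: eq_bigr => l _; rewrite mxE.
Qed.

Variables (B : 'M[R]_n.+1) (P : 'M[R]_n) (e f : 'I_n -> V).
Hypothesis PE : forall i, B *m e i = \sum_j P i j *: f j.
Let HB u v := H (B *m u) (B *m v).
Let TB u v w := T (B *m u) (B *m v) (B *m w).

(* The tangential part of the image under [B] of the unit normal enters the
   mixed term through its own Hessian row; by symmetry of [H], raising the index
   gives it back, and it cancels: only the normal part remains. *)
Lemma form_AN_vector_pullback :
    B \in unitmx -> P \in unitmx -> a != 0 -> orthonormal_perp a f ->
    form_block H f \in unitmx ->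
  B *m form_AN_vector (B^T *m a) HB TB e =
    (enorm (B^T *m a) / enorm a) *: form_AN_vector a H T f.
Proof.
move=> uB uP a0 fP uF.
have na := lt0r_neq0 (enorm_gt0 a0).
have b0 : B^T *m a != 0.
  by rewrite -(mulmx0 _ B^T) (can_eq (mulKmx _))// unitmx_tr.
have nb := lt0r_neq0 (enorm_gt0 b0).
set kappa := _ / _.
have bE : enorm (B^T *m a) = kappa * enorm a by rewrite divfK.
pose nu := (enorm a)^-1 *: a; pose nuB := (enorm (B^T *m a))^-1 *: (B^T *m a).
pose F := form_block H f.
pose c j := dot (f j) (B *m nuB).
(* The normal component is [kappa] because [dot a (B *m nuB) = dot (B^T *m a) nuB = enorm (B^T *m
   a)]. *)
have nuBE : B *m nuB = kappa *: nu + \sum_j c j *: f j.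
  rewrite {1}(perp_expand (B *m nuB) a0 fP); congr (_ *: _ + _).
  by rewrite -dot_trmx dotZr dotvv expr2 mulKf.
pose tau w := \sum_p \sum_q invmx F p q * T (f p) (f q) w.
(* [S0] and [S] are the covectors whose index the formula raises, for the original and the
   pulled-back data; both are read on the target side of [B] and share the trace [tau]. *)
pose S0 w := - (n + 2)%:R^-1 * enorm a * tau w + H nu w.
pose S w := - (n + 2)%:R^-1 * enorm (B^T *m a) * tau w + H (B *m nuB) w.
have tau_linear : linear (tau : V -> R^o).
  move=> k u v; rewrite /tau scaler_sumr -big_split; apply: eq_bigr => p _.
  rewrite scaler_sumr -big_split; apply: eq_bigr => q _.
  by rewrite T_linear3 mulrDr [in LHS]/GRing.scale/= mulrCA.
have S_linear : linear (S : V -> R^o).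
  move=> k u v; rewrite /S tau_linear H_linearr /GRing.scale/=; ring.
have SE l : S (f l) = kappa * S0 (f l) + \sum_j c j * F j l.
  rewrite /S nuBE H_linearl (linear_sumZ _ _ (H_linearl (f l))) /S0 bE.
  under [in RHS]eq_bigr do rewrite mxE.
  rewrite /GRing.scale/=; ring.
have raise_row k : \sum_l invmx F k l * (\sum_j c j * F j l) = c k.
  transitivity (\sum_j c j * (invmx F *m F) k j).
    under eq_bigr do rewrite mulr_sumr.
    rewrite exchange_big; apply: eq_bigr => j _.
    rewrite mxE mulr_sumr; apply: eq_bigr => l _.
    by rewrite mulrCA; congr (_ * (_ * _)); rewrite !mxE H_sym.
  rewrite mulVmx// (bigD1 k)//= mxE eqxx mulr1 big1 ?addr0// => j jk.
  by rewrite mxE eq_sym (negPf jk) mulr0.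
have GE : form_block HB e = P *m F *m P^T := form_block_change_basis PE.
have tauE w : \sum_p \sum_q invmx (form_block HB e) p q *
    T (B *m e p) (B *m e q) w = tau w.
  rewrite GE.
  exact: (contraction_change_basis (W := R^o) (Phi := fun u v => T u v w)
    (fun v => T_linear1 v w) (fun u => T_linear2 u w) PE uP uF).
transitivity (\sum_i \sum_j invmx (form_block HB e) i j *:
    (S (B *m e j) *: (B *m e i)) - B *m nuB).
  rewrite mulmxBr mulmx_sumr; congr (_ - _); apply: eq_bigr => i _.
  rewrite -scalemxAr scaler_suml; apply: eq_bigr => j _.
  by rewrite scalerA /S -tauE.
rewrite GE.
(* The whole tangential part is a single contraction of a vector-valued bilinear map, so it passes
   from the images of [e] to [f] at once. *)
rewrite (contraction_change_basis (Phi := fun u v => S v *: u) _ _ PE uP uF).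
- rewrite nuBE opprD addrA addrAC scalerBr; congr (_ - _).
  rewrite scaler_sumr -sumrB; apply: eq_bigr => k _.
  rewrite -[c k]raise_row scalerA.
  under eq_bigr do rewrite scalerA SE mulrDr.
  rewrite -scaler_suml -scalerBl; congr (_ *: _).
  rewrite big_split addrK mulr_sumr; apply: eq_bigr => l _.
  by rewrite mulrCA.
- by move=> v k u u'; rewrite scalerDr scalerA mulrC -scalerA.
- by move=> u k v v'; rewrite S_linear scalerDl -scalerA.
Qed.

End MultilinearForms.

(** * Derivatives and affine normal vectors under composition with a linear map *)

Section LinearChangeOfVariables.
Variables (R : realType) (n : nat).
Local Notation V := 'cV[R]_n.+1.
Implicit Types (h : V -> R) (x u v w : V) (e f : 'I_n -> V).

(** The two difference quotients are the same function of [t]; the identity can thus be iterated to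
    reach [D2] and [D3]. *)
Lemma derive_comp_mulmx h (B : 'M[R]_n.+1) v x :
  'D_v (fun z => h (B *m z)) x = 'D_(B *m v) h (B *m x).
Proof.
have quotE : (fun t : R => t^-1 *: (((fun z => h (B *m z)) \o shift x) (t *: v)
      - h (B *m x))) =
    (fun t => t^-1 *: ((h \o shift (B *m x)) (t *: (B *m v)) - h (B *m x))).
  by apply/funext => t /=; rewrite mulmxDr -scalemxAr.
by rewrite /derive quotE.
Qed.

Lemma D2_comp_mulmx h (B : 'M[R]_n.+1) x u v :
  D2 (fun z => h (B *m z)) x u v = D2 h (B *m x) (B *m u) (B *m v).
Proof.
have DE : 'D_v (fun z => h (B *m z)) = (fun z => 'D_(B *m v) h (B *m z)).
  by apply/funext => z; exact: (derive_comp_mulmx h B v z).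
rewrite [LHS](congr1 (fun k => 'D_u k x) DE).
exact: (derive_comp_mulmx ('D_(B *m v) h) B u x).
Qed.

Lemma D3_comp_mulmx h (B : 'M[R]_n.+1) x u v w :
  D3 (fun z => h (B *m z)) x u v w = D3 h (B *m x) (B *m u) (B *m v) (B *m w).
Proof.
have D2E : 'D_v ('D_w (fun z => h (B *m z))) =
    (fun z => D2 h (B *m z) (B *m v) (B *m w)).
  by apply/funext => z; exact: (D2_comp_mulmx h B z v w).
rewrite [LHS](congr1 (fun k => 'D_u k x) D2E).
exact: (derive_comp_mulmx (fun z => D2 h z (B *m v) (B *m w)) B u x).
Qed.

Lemma dot_grad h x v : differentiable h x -> dot (grad h x) v = 'D_v h x.
Proof.
move=> dh; have -> : v = \sum_i v i 0 *: delta_mx i 0.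
  rewrite {1}[v]matrix_sum_delta; apply: eq_bigr => i _.
  by rewrite big_ord1.
rewrite (linear_sumZ _ _ (derive_linear dh)) (linear_sumZ _ _ (dot_linear _)).
apply: eq_bigr => i _; congr (_ *: _).
rewrite /dot (bigD1 i)//= big1 => [|j ji]; rewrite !mxE ?eqxx ?mulr1 ?addr0//.
by rewrite (negPf ji) mulr0.
Qed.

Lemma grad_comp_mulmx h (B : 'M[R]_n.+1) x : differentiable h (B *m x) ->
  grad (fun z => h (B *m z)) x = B^T *m grad h (B *m x).
Proof.
move=> dh; apply/colP => i; rewrite [LHS]mxE derive_comp_mulmx -dot_grad//.
rewrite mxE; apply: eq_bigr => k _; rewrite mulrC [(B^T) i k]mxE -[in LHS]colE.
by rewrite [col _ _ _ _]mxE.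
Qed.

(** [AN_well_defined] provides one frame with invertible block, while a direction may come from
    another. The case [B = 1] of [change_of_frame] makes the two blocks congruent. *)
Lemma tangent_block_unitmx h x e f : class_C 3 h -> grad h x != 0 ->
    tangent_frame h x e -> tangent_frame h x f ->
  tangent_block h x f \in unitmx -> tangent_block h x e \in unitmx.
Proof.
move=> hC3 a0 eP fP uF.
have eP1 : orthonormal_perp (1%:M^T *m grad h x) e by rewrite trmx1 mul1mx.
have [P uP PE] := change_of_frame (unitmx1 _ _) a0 eP1 fP.
have -> : tangent_block h x e = P *m tangent_block h x f *m P^T.
  apply: (form_block_change_basis (D2_linearl hC3 x) (D2_linearr hC3 x)).
  by move=> i; rewrite -PE mul1mx.
by rewrite !unitmx_mul uP uF unitmx_tr.
Qed.

Lemma AN_vector_comp_mulmx psi (B : 'M[R]_n.+1) x e f : class_C 3 psi ->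
    B \in unitmx -> AN_well_defined psi (B *m x) ->
    tangent_frame (fun z => psi (B *m z)) x e -> tangent_frame psi (B *m x) f ->
  B *m AN_vector (fun z => psi (B *m z)) x e =
    (enorm (B^T *m grad psi (B *m x)) / enorm (grad psi (B *m x))) *:
      AN_vector psi (B *m x) f.
Proof.
move=> psi_C3 uB [a0 [f0 f0P uF0]] eP fP.
have uF := tangent_block_unitmx psi_C3 a0 fP f0P uF0.
have gradE := grad_comp_mulmx (C3_diff psi_C3 (B *m x)).
rewrite /tangent_frame gradE in eP.
have [P uP PE] := change_of_frame uB a0 eP fP.
(* The two sides agree by unfolding; in the abstract form the gradient and each derivative can be
   rewritten separately. *)
have -> : AN_vector (fun z => psi (B *m z)) x e =
    form_AN_vector (grad (fun z => psi (B *m z)) x)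
      (D2 (fun z => psi (B *m z)) x) (D3 (fun z => psi (B *m z)) x) e by [].
rewrite gradE.
have -> : D2 (fun z => psi (B *m z)) x =
    fun u v => D2 psi (B *m x) (B *m u) (B *m v).
  by apply/funext => u; apply/funext => v; exact: D2_comp_mulmx.
have -> : D3 (fun z => psi (B *m z)) x =
    fun u v w => D3 psi (B *m x) (B *m u) (B *m v) (B *m w).
  apply/funext => u; apply/funext => v; apply/funext => w.
  exact: D3_comp_mulmx.
exact: (form_AN_vector_pullback
  (D2_linearl psi_C3 (B *m x)) (D2_linearr psi_C3 (B *m x)) (D2_sym psi_C3 (B *m x))
  (D3_linear1 psi_C3 (B *m x)) (D3_linear2 psi_C3 (B *m x))
  (D3_linear3 psi_C3 (B *m x)) PE uB uP a0 fP uF).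
Qed.

End LinearChangeOfVariables.

Theorem lemma9p1 (R : realType) (n : nat)
  (psi : 'cV[R]_n.+1 -> R) (psi_C3 : class_C 3 psi)
  (B : 'M[R]_n.+1) (B_unit : B \in unitmx) (detB : \det B = 1)
  (g : 'cV[R]_n.+1 -> R) (gE : forall z, g z = psi (B *m z))
  (x : 'cV[R]_n.+1)
  (wd_g : AN_well_defined g x) (wd_psi : AN_well_defined psi (B *m x))
  (dg dpsi : 'cV[R]_n.+1)
  (dgP : is_AN_direction g x dg)
  (dpsiP : is_AN_direction psi (B *m x) dpsi) :
  pos_parallel dg (invmx B *m dpsi).
Proof.
have gE' : g = (fun z => psi (B *m z)) by exact/funext.
move: wd_g dgP; rewrite gE' => -[b0 _] [e eP [c c0 ->]].
case: dpsiP => f fP [d d0 ->].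
have a0 := wd_psi.1.
have gradE := grad_comp_mulmx (C3_diff psi_C3 (B *m x)).
rewrite gradE in b0.
(* Here [c] and [d] are the scalars of the representatives [dg] and [dpsi], and the middle factor is
   the ratio [kappa] between the two affine normal vectors. *)
exists (c * (enorm (B^T *m grad psi (B *m x)) / enorm (grad psi (B *m x))) / d).
  by rewrite divr_gt0 ?mulr_gt0 ?invr_gt0 ?enorm_gt0.
rewrite -scalemxAr scalerA divfK ?lt0r_neq0// -scalerA; congr (_ *: _).
apply: (can_inj (mulKmx B_unit)).
by rewrite -scalemxAr mulKVmx// (AN_vector_comp_mulmx psi_C3 B_unit wd_psi eP fP).
Qed.
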